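(* Let $(\bar{S},\bar{D})$ be an $(N+1)$-dimensional securities market model with gains process $\bar G=\bar S+\bar D$, $d\bar G=\bar\mu\,dt+\bar\sigma\,dW$. Let $\bar b$ be a money market account for $(\bar S,\bar D)$ with value process $M$ and interest rate process $r$, and assume $\bar D\in\mathcal{L}(1/M)$. Suppose $\lambda$ is a vector of instantaneous prices of risk, i.e. an adapted measurable $K$-dimensional row-vector-valued process such that $\bar\mu-r\bar S=\bar\sigma\lambda^\top$ almost everywhere, and suppose $\bar{\psi}$ is a trading strategy such that $$\bar{\mu} - r \bar{S} = \bar{\sigma}\bar{\sigma}^{\top}\bar{\psi}^{\top}$$ almost everywhere. Set $\lambda^{*} = \bar{\psi} \bar{\sigma}$. Then $\lambda^{*}\lambda^{*\top} \leq \lambda\lambda^{\top}$ almost everywhere.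
   Context: Setting: $(\Omega,\mathcal{F},P)$ is a complete probability space with a filtration $\{\mathcal{F}_t\}_{t\in\mathcal{T}}$, where $\mathcal{T}$ is the time interval ($[0,T]$ or $[0,\infty)$), and $W$ is a $K$-dimensional Wiener process relative to the filtration. ''Measurable'' process means jointly measurable on $\Omega\times\mathcal{T}$; ''almost everywhere'' refers to the product of $P$ and Lebesgue measure on $\Omega\times\mathcal{T}$. $\mathcal{L}^1$ (resp. $\mathcal{L}^2$) is the set of adapted, measurable, pathwise integrable (resp. pathwise square integrable) processes (over each $[0,t]$, $t\in\mathcal T$). Time integrals and stochastic integrals of such processes are understood to be continuous adapted processes, and equality of such processes is up to indistinguishability. Securities market model: a pair $(\bar S,\bar D)$ of adapted measurable $(N+1)$-dimensional (column vector) processes (prices and cumulative dividends) with $\bar D(0)=0$ such that $\bar G=\bar S+\bar D$ is an Itô process: $\bar G(t)=\bar G(0)+\int_0^t\bar\mu\,ds+\int_0^t\bar\sigma\,dW$, with $\bar\mu$ an $(N+1)$-dimensional process in $\mathcal{L}^1$ and $\bar\sigma$ an $(N+1)\times K$ matrix-valued process in $\mathcal{L}^2$. A trading strategy is an adapted, measurable $(N+1)$-dimensional row-vector-valued process $\bar\Delta$; its value process is $\bar\Delta\bar S$. $\mathcal{L}(\bar G)$ is the set of trading strategies with $\bar\Delta\bar\mu\in\mathcal{L}^1$, $\bar\Delta\bar\sigma\in\mathcal{L}^2$. A trading strategy $\bar\Delta\in\mathcal{L}(\bar G)$ is self-financing if $\bar\Delta(t)\bar S(t)=\bar\Delta(0)\bar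 S(0)+\int_0^t\bar\Delta\,d\bar G$ for all $t$. A money market account is a self-financing trading strategy $\bar b$ whose value process $M=\bar b\bar S$ is positive and instantaneously riskless (zero dispersion, i.e. zero $dW$-coefficient). Then $M(t)=M(0)\exp\{\int_0^t r\,ds\}$ for some $r\in\mathcal{L}^1$, the interest rate process. The condition $\bar D\in\mathcal{L}(1/M)$ is equivalent to $\bar D r\in\mathcal{L}^1$. *)

(* Defs.v *)
From HB Require Import structures.
From mathcomp Require Import all_boot all_order all_algebra.
From mathcomp Require Import all_classical all_reals all_analysis.
Set Implicit Arguments.
Unset Strict Implicit.
Unset Printing Implicit Defensive.
Import Order.TTheory GRing.Theory Num.Theory.
Import numFieldNormedType.Exports.

Local Open Scope classical_set_scope.
Local Open Scope ring_scope.

(* A process on [Omega] is a function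
   [Omega -> R -> 'M[R]_(m, n)]; only its values at times in the time interval
   [T : set R] are meaningful.  Scalar processes [Omega -> R -> R] are turned
   into 1 x 1 processes by [mxproc]. *)

Definition time_interval (R : realType) (T : set R) : Prop :=
  (exists2 u : R, 0 < u & T = [set` `[0, u]]) \/ T = [set` `[0, +oo[].

Definition filtration (R : realType) (d : measure_display)
    (Omega : measurableType d) (T : set R) (F : R -> set (set Omega)) : Prop :=
  [/\ forall t, T t -> sigma_algebra [set: Omega] (F t),
      forall t, T t -> F t `<=` measurable &
      forall s t, T s -> T t -> s <= t -> F s `<=` F t].

Definition mxproc (R : realType) (Omega : Type) (X : Omega -> R -> R) :
    Omega -> R -> 'M[R]_1 := fun w t => (X w t)%:M.

Definition sub_measurable (R : realType) (Omega : Type) (G : set (set Omega))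
    (m n : nat) (f : Omega -> 'M[R]_(m, n)) : Prop :=
  forall i j (B : set R), measurable B -> G ((fun w => f w i j) @^-1` B).

Definition adapted (R : realType) (Omega : Type) (T : set R)
    (F : R -> set (set Omega)) (m n : nat)
    (X : Omega -> R -> 'M[R]_(m, n)) : Prop :=
  forall t, T t -> sub_measurable (F t) (X ^~ t).

Definition measurable_process (R : realType) (d : measure_display)
    (Omega : measurableType d) (T : set R) (m n : nat)
    (X : Omega -> R -> 'M[R]_(m, n)) : Prop :=
  forall i j, measurable_fun ([set: Omega] `*` T)
    (fun p : Omega * measurableTypeR R => X p.1 p.2 i j).

Definition as_continuous (R : realType) (d : measure_display)
    (Omega : measurableType d) (P : probability Omega R) (T : set R)
    (m n : nat) (X : Omega -> R -> 'M[R]_(m, n)) : Prop :=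
  {ae P, forall w, forall i j, {within T, continuous (fun t => X w t i j)}}.

Definition ae_on (R : realType) (d : measure_display)
    (Omega : measurableType d) (P : probability Omega R) (T : set R)
    (Q : Omega -> R -> Prop) : Prop :=
  {ae (P \x @lebesgue_measure R)%E,
    forall p : Omega * measurableTypeR R, T p.2 -> Q p.1 p.2}.

Definition indistinguishable (R : realType) (d : measure_display)
    (Omega : measurableType d) (P : probability Omega R) (T : set R)
    (m n : nat) (X Y : Omega -> R -> 'M[R]_(m, n)) : Prop :=
  {ae P, forall w, forall t, T t -> X w t = Y w t}.

(* The product formula says at once that the increment W(t) - W(s) is
   independent of F_s, that its components are independent, and that each of
   them is N(0, t - s); the second parameter of [normal_prob] is the standard
   deviation. *)
Definition wiener (R : realType) (d : measure_display)
    (Omega : measurableType d) (P : probability Omega R) (T : set R)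
    (F : R -> set (set Omega)) (K : nat) (W : Omega -> R -> 'cV[R]_K) : Prop :=
  [/\ adapted T F W,
      as_continuous P T W,
      {ae P, forall w, W w 0 = 0} &
      forall s t, T s -> T t -> s < t ->
      forall (A : set Omega) (B : 'I_K -> set R),
        F s A -> (forall k, measurable (B k)) ->
        P (A `&` [set w | forall k, B k (W w t k 0 - W w s k 0)]) =
        (P A * \prod_(k < K) normal_prob 0 (Num.sqrt (t - s)) (B k))%E].

Definition L1proc (R : realType) (d : measure_display)
    (Omega : measurableType d) (P : probability Omega R) (T : set R)
    (F : R -> set (set Omega)) (m n : nat)
    (X : Omega -> R -> 'M[R]_(m, n)) : Prop :=
  [/\ adapted T F X, measurable_process T X &
      {ae P, forall w, forall t, T t -> forall i j,
        (@lebesgue_measure R).-integrable `[0, t] (fun s => (X w s i j)%:E)}].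

Definition L2proc (R : realType) (d : measure_display)
    (Omega : measurableType d) (P : probability Omega R) (T : set R)
    (F : R -> set (set Omega)) (m n : nat)
    (X : Omega -> R -> 'M[R]_(m, n)) : Prop :=
  [/\ adapted T F X, measurable_process T X &
      {ae P, forall w, forall t, T t -> forall i j,
        (@lebesgue_measure R).-integrable `[0, t]
          (fun s => (X w s i j ^+ 2)%:E)}].

Definition time_integral (R : realType) (Omega : Type) (m n : nat)
    (X : Omega -> R -> 'M[R]_(m, n)) : Omega -> R -> 'M[R]_(m, n) :=
  fun w t => \matrix_(i, j)
    (\int[@lebesgue_measure R]_(s in `[0%R, t]) X w s i j)%R.

(* Simple integrands  \sum_i xi_i 1_(t_i, t_(i+1)]  with finitely many
   deterministic times and bounded F_(t_i)-measurable coefficients, and their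
   elementary integrals. *)
Record simple_integrand (R : realType) (d : measure_display)
    (Omega : measurableType d) (T : set R) (F : R -> set (set Omega))
    (m K : nat) := SimpleIntegrand {
  si_size : nat ;
  si_time : nat -> R ;
  si_coef : nat -> Omega -> 'M[R]_(m, K) ;
  si_time_in : forall i, T (si_time i) ;
  si_time_le : forall i, si_time i <= si_time i.+1 ;
  si_coef_meas : forall i, sub_measurable (F (si_time i)) (si_coef i) ;
  si_coef_bounded : forall i, exists C : R,
    forall w j k, `|si_coef i w j k| <= C }.

Definition si_process (R : realType) (d : measure_display)
    (Omega : measurableType d) (T : set R) (F : R -> set (set Omega))
    (m K : nat) (H : simple_integrand T F m K) : Omega -> R -> 'M[R]_(m, K) :=
  fun w s => \sum_(i < si_size H | si_time H i < s <= si_time H i.+1)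
    si_coef H i w.

Definition si_integral (R : realType) (d : measure_display)
    (Omega : measurableType d) (T : set R) (F : R -> set (set Omega))
    (m K : nat) (H : simple_integrand T F m K) (W : Omega -> R -> 'cV[R]_K) :
    Omega -> R -> 'cV[R]_m :=
  fun w t => \sum_(i < si_size H) si_coef H i w *m
    (W w (Num.min t (si_time H i.+1)) - W w (Num.min t (si_time H i))).

Definition cvg0_in_probability (R : realType) (d : measure_display)
    (Omega : measurableType d) (P : probability Omega R)
    (Y : nat -> Omega -> \bar R) : Prop :=
  forall e : R, 0 < e ->
    P [set w | (e%:E <= Y n w)%E] @[n --> \oo] --> 0%E.

(* [is_ito_integral P T F W H I]: the process I is (a version of) the
   stochastic integral  t |-> \int_0^t H dW  of the integrand H in L^2.  It is
   the continuous adapted process obtained as the limit in probability of the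
   elementary integrals of simple integrands H_n for which
   \int_0^t |H_n - H|^2 ds  tends to 0 in probability; the limit does not depend
   on the choice of the H_n, and determines I up to indistinguishability. *)
Definition is_ito_integral (R : realType) (d : measure_display)
    (Omega : measurableType d) (P : probability Omega R) (T : set R)
    (F : R -> set (set Omega)) (m K : nat) (W : Omega -> R -> 'cV[R]_K)
    (H : Omega -> R -> 'M[R]_(m, K)) (I : Omega -> R -> 'cV[R]_m) : Prop :=
  [/\ L2proc P T F H, adapted T F I, as_continuous P T I &
      exists Hn : nat -> simple_integrand T F m K, forall t, T t ->
        cvg0_in_probability P (fun n w =>
          (\int[@lebesgue_measure R]_(s in `[0%R, t])
            (\sum_(i < m) \sum_(k < K)
               (si_process (Hn n) w s i k - H w s i k) ^+ 2)%:E)%E) /\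
        (forall i, cvg0_in_probability P (fun n w =>
          `|si_integral (Hn n) W w t i 0 - I w t i 0|%:E))].

Definition ito_process (R : realType) (d : measure_display)
    (Omega : measurableType d) (P : probability Omega R) (T : set R)
    (F : R -> set (set Omega)) (m K : nat) (W : Omega -> R -> 'cV[R]_K)
    (X mu : Omega -> R -> 'cV[R]_m) (sigma : Omega -> R -> 'M[R]_(m, K)) :
    Prop :=
  [/\ adapted T F X, L1proc P T F mu, L2proc P T F sigma &
      exists2 I, is_ito_integral P T F W sigma I &
        indistinguishable P T X
          (fun w t => X w 0 + time_integral mu w t + I w t)].

(* Integrands for an Ito process dX = mu dt + sigma dW.  They are matrix-valued:
   row vectors for trading strategies, columns when X is scalar. *)
Definition ito_integrand (R : realType) (d : measure_display)
    (Omega : measurableType d) (P : probability Omega R) (T : set R)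
    (F : R -> set (set Omega)) (p m K : nat)
    (mu : Omega -> R -> 'cV[R]_m) (sigma : Omega -> R -> 'M[R]_(m, K))
    (Delta : Omega -> R -> 'M[R]_(p, m)) : Prop :=
  [/\ adapted T F Delta, measurable_process T Delta,
      L1proc P T F (fun w t => Delta w t *m mu w t) &
      L2proc P T F (fun w t => Delta w t *m sigma w t)].

(* The class L(X) of an Ito process X given without its coefficients. *)
Definition Lproc (R : realType) (d : measure_display)
    (Omega : measurableType d) (P : probability Omega R) (T : set R)
    (F : R -> set (set Omega)) (p m K : nat) (W : Omega -> R -> 'cV[R]_K)
    (X : Omega -> R -> 'cV[R]_m) (Delta : Omega -> R -> 'M[R]_(p, m)) : Prop :=
  exists mu sigma,
    ito_process P T F W X mu sigma /\ ito_integrand P T F mu sigma Delta.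

Definition securities_market_model (R : realType) (d : measure_display)
    (Omega : measurableType d) (P : probability Omega R) (T : set R)
    (F : R -> set (set Omega)) (N K : nat) (W : Omega -> R -> 'cV[R]_K)
    (S D mu : Omega -> R -> 'cV[R]_N.+1)
    (sigma : Omega -> R -> 'M[R]_(N.+1, K)) : Prop :=
  [/\ adapted T F S /\ measurable_process T S,
      adapted T F D /\ measurable_process T D,
      {ae P, forall w, D w 0 = 0} &
      ito_process P T F W (fun w t => S w t + D w t) mu sigma].

Definition trading_strategy (R : realType) (d : measure_display)
    (Omega : measurableType d) (T : set R) (F : R -> set (set Omega)) (N : nat)
    (Delta : Omega -> R -> 'rV[R]_N.+1) : Prop :=
  adapted T F Delta /\ measurable_process T Delta.

Definition value_process (R : realType) (Omega : Type) (N : nat)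
    (S : Omega -> R -> 'cV[R]_N.+1) (Delta : Omega -> R -> 'rV[R]_N.+1) :
    Omega -> R -> R := fun w t => (Delta w t *m S w t) 0 0.

(* Since \int Delta dG = \int Delta mu dt + \int Delta sigma dW, the
   self-financing equation says that the value process is an Ito process with
   coefficients Delta mu and Delta sigma. *)
Definition self_financing (R : realType) (d : measure_display)
    (Omega : measurableType d) (P : probability Omega R) (T : set R)
    (F : R -> set (set Omega)) (N K : nat) (W : Omega -> R -> 'cV[R]_K)
    (S mu : Omega -> R -> 'cV[R]_N.+1)
    (sigma : Omega -> R -> 'M[R]_(N.+1, K))
    (Delta : Omega -> R -> 'rV[R]_N.+1) : Prop :=
  ito_integrand P T F mu sigma Delta /\
  ito_process P T F W (mxproc (value_process S Delta))
    (fun w t => Delta w t *m mu w t) (fun w t => Delta w t *m sigma w t).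

(* The dispersion of the value process of a self-financing b is b sigma. *)
Definition money_market_account (R : realType) (d : measure_display)
    (Omega : measurableType d) (P : probability Omega R) (T : set R)
    (F : R -> set (set Omega)) (N K : nat) (W : Omega -> R -> 'cV[R]_K)
    (S mu : Omega -> R -> 'cV[R]_N.+1)
    (sigma : Omega -> R -> 'M[R]_(N.+1, K))
    (b : Omega -> R -> 'rV[R]_N.+1) : Prop :=
  [/\ trading_strategy T F b,
      self_financing P T F W S mu sigma b,
      {ae P, forall w, forall t, T t -> 0 < value_process S b w t} &
      ae_on P T (fun w t => b w t *m sigma w t = 0)].

Definition interest_rate_process (R : realType) (d : measure_display)
    (Omega : measurableType d) (P : probability Omega R) (T : set R)
    (F : R -> set (set Omega)) (M r : Omega -> R -> R) : Prop :=
  L1proc P T F (mxproc r) /\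
  {ae P, forall w, forall t, T t ->
    M w t = M w 0 *
      expR (\int[@lebesgue_measure R]_(s in `[0%R, t]) r w s)%R}.

Definition prices_of_risk (R : realType) (d : measure_display)
    (Omega : measurableType d) (P : probability Omega R) (T : set R)
    (F : R -> set (set Omega)) (N K : nat)
    (S mu : Omega -> R -> 'cV[R]_N.+1)
    (sigma : Omega -> R -> 'M[R]_(N.+1, K)) (r : Omega -> R -> R)
    (lambda : Omega -> R -> 'rV[R]_K) : Prop :=
  [/\ adapted T F lambda, measurable_process T lambda &
      ae_on P T (fun w t =>
        mu w t - r w t *: S w t = sigma w t *m (lambda w t)^T)].

(* Main.v *)
(* Pointwise, [sigma lambda^T = sigma lambda_star^T] with [lambda_star] in the
   row space of [sigma], so [lambda - lambda_star] is orthogonal to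
   [lambda_star] and Pythagoras' theorem applies. *)

Require Import Defs.
From HB Require Import structures.
From mathcomp Require Import all_boot all_order all_algebra.
From mathcomp Require Import all_classical all_reals all_analysis.
Import Order.TTheory GRing.Theory Num.Theory.
Import numFieldNormedType.Exports.

Local Open Scope classical_set_scope.
Local Open Scope ring_scope.

(** At almost every point, [lambda^T] and [lambda_star^T] solve the same linear system, with matrix
    [sigma] and right-hand side [mu - r S]. A solution in the row space of [sigma] is orthogonal to
    the kernel, so it has the least norm of all solutions; [row_space_norm_min] is this fact. *)

Lemma mulmx_tr_ge0 (R : realDomainType) (n : nat) (v : 'rV[R]_n) :
  0 <= (v *m v^T) 0 0.
Proof.
rewrite mxE; apply: sumr_ge0 => i _.
by rewrite mxE -expr2 sqr_ge0.
Qed.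

Lemma row_space_norm_min (R : realDomainType) (m n : nat) (A : 'M[R]_(m, n))
    (x : 'rV[R]_m) (v : 'rV[R]_n) :
  A *m v^T = A *m (x *m A)^T ->
  ((x *m A) *m (x *m A)^T) 0 0 <= (v *m v^T) 0 0.
Proof.
set u := x *m A => eqAvu.
(* Orthogonality: [v - u] is killed by [A], and [u] is a combination of rows of [A]. *)
have uv : u *m v^T = u *m u^T by rewrite /u -!mulmxA eqAvu.
have vu : v *m u^T = u *m u^T.
  by rewrite -[v *m _]trmxK [(v *m _)^T]trmx_mul trmxK uv trmx_mul trmxK.
(* By [uv] and [vu], both cross terms of the expansion equal [u *m u^T]. *)
have pyth : v *m v^T = u *m u^T + (v - u) *m (v - u)^T.
  by rewrite linearB /= mulmxBl !mulmxBr uv vu subrr subr0 addrC subrK.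
by rewrite pyth [leRHS]mxE lerDl mulmx_tr_ge0.
Qed.

Theorem proposition4 (R : realType) (d : measure_display)
    (Omega : measurableType d) (P : probability Omega R)
    (T : set R) (F : R -> set (set Omega)) (N K : nat)
    (W : Omega -> R -> 'cV[R]_K)
    (S D mu : Omega -> R -> 'cV[R]_N.+1)
    (sigma : Omega -> R -> 'M[R]_(N.+1, K))
    (b : Omega -> R -> 'rV[R]_N.+1) (r : Omega -> R -> R)
    (lambda : Omega -> R -> 'rV[R]_K)
    (psi : Omega -> R -> 'rV[R]_N.+1)
    (hP : measure_is_complete P)
    (hT : time_interval T)
    (hF : filtration T F)
    (hW : wiener P T F W)
    (hSD : securities_market_model P T F W S D mu sigma)
    (hb : money_market_account P T F W S mu sigma b)
    (hr : interest_rate_process P T F (value_process S b) r)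
    (hD : Lproc P T F W (mxproc (fun w t => (value_process S b w t)^-1)) D)
    (hlambda : prices_of_risk P T F S mu sigma r lambda)
    (hpsi : trading_strategy T F psi)
    (hpsi_eq : ae_on P T (fun w t =>
       mu w t - r w t *: S w t =
       sigma w t *m (sigma w t)^T *m (psi w t)^T)) :
  let lambda_star := fun w t => psi w t *m sigma w t in
  ae_on P T (fun w t =>
    (lambda_star w t *m (lambda_star w t)^T) 0 0
      <= (lambda w t *m (lambda w t)^T) 0 0).
Proof.
move=> lambda_star; have [_ _ lambda_eq] := hlambda.
apply: filterS2 lambda_eq hpsi_eq => p eq_lambda eq_psi Tp.
apply: row_space_norm_min.
(* Both sides of the system's equation pass through the common excess drift, [psi] being the vector
   of row coefficients. *)
by rewrite -(eq_lambda Tp) (eq_psi Tp) trmx_mul mulmxA.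
Qed.
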